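(* Let $0<r\le 0.85$. Consider the unweighted graph with vertex set $V=\{x,y,z,w\}$ and edge set $E=\{\{x,y\},\{y,z\},\{z,w\},\{w,x\},\{y,w\}\}$, with the signature $\sigma:E^{or}\to U(2)$ given by $$\sigma_{xy}=\sigma_{yz}=\sigma_{yw}=I_2,\qquad \sigma_{xw}=B_1,\qquad \sigma_{zw}=B_2$$ (and $\sigma_{vu}=\sigma_{uv}^{-1}$), where $B_k=A_3^{-1}A_k$ with $$A_k=\begin{pmatrix} re^{i\alpha_k}&-\sqrt{1-r^2}\\ \sqrt{1-r^2}&re^{-i\alpha_k}\end{pmatrix},\qquad \alpha_k=\frac{2(k-1)\pi}{3},\quad k=1,2,3 .$$ Then $$\iota_F^\sigma(V):=\min_{\tau:V\to U(2)}\sum_{\{u,v\}\in E}|\sigma_{uv}\tau(v)-\tau(u)|_F<\min_{T\in\mathbb{T}_V}\sum_{\{u,v\}\in E}|\sigma_{uv}\tau_T(v)-\tau_T(u)|_F,$$ where, for each spanning tree $T$, $\tau_T$ is a representative of the set $C_T(V)$.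
   Context: $|\cdot|_F$ is the Frobenius norm $|A|_F=(\sum_{i,j}|a_{ij}|^2)^{1/2}$; $I_2$ is the $2\times2$ identity matrix; $E^{or}$ is the set of oriented edges. $\mathbb{T}_V$ is the set of all spanning trees of the graph. $C_T(V)$ is the set of all $\tau:V\to U(2)$ that are constant on $T$ with respect to $\sigma$, i.e. $\sigma_{uv}\tau(v)=\tau(u)$ for every oriented edge $(u,v)$ of $T$. Any two elements of $C_T(V)$ differ by right multiplication by a constant unitary matrix, so the sums do not depend on the choice of $\tau_T$ (nor on orientations of edges). *)

(* Defs.v *)
From HB Require Import structures.
From mathcomp Require Export all_boot all_order all_algebra.
From mathcomp Require Export all_classical all_reals all_analysis.
From mathcomp Require Export complex.
From mathcomp Require Import ring lra.

Set Implicit Arguments.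
Unset Strict Implicit.
Unset Printing Implicit Defensive.

Import Order.TTheory GRing.Theory Num.Theory.

Local Open Scope classical_set_scope.
Local Open Scope ring_scope.
Local Open Scope complex_scope.

Section Graph.
Variable V : finType.

(* A graph on V is given by its set E of edges, each an unordered pair
   [set u; v] with u != v. *)
Definition adj (E : {set {set V}}) : rel V :=
  [rel u v | (u != v) && ([set u; v]%SET \in E)].

Definition acyclic (E : {set {set V}}) :=
  forall c : seq V, (2 < size c)%N -> ~ ucycle (adj E) c.

Definition connected_graph (E : {set {set V}}) :=
  forall u v : V, connect (adj E) u v.

Definition spanning_tree (E T : {set {set V}}) :=
  [/\ T \subset E, connected_graph T & acyclic T].

End Graph.

Section Signature.
Variables (R : realType) (V : finType) (d : nat).
Implicit Types (E T : {set {set V}}) (sigma : V -> V -> 'M[R[i]]_d)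
  (tau : V -> 'M[R[i]]_d).

Definition frobenius_norm m n (A : 'M[R[i]]_(m, n)) : R :=
  Num.sqrt (\sum_(i < m) \sum_(j < n) ComplexField.Normc.normc (A i j) ^+ 2).

Definition is_signature E sigma :=
  forall u v, adj E u v ->
    sigma u v \is unitarymx /\ sigma v u = invmx (sigma u v).

Definition unitary_valued tau := forall v, tau v \is unitarymx.

(* Each edge {u, v} contributes one term, for the orientation (u, v) in which
   u precedes v in the enumeration of V.  For unitary-valued signatures, the
   term does not depend on the orientation. *)
Definition frustration E sigma tau : R :=
  \sum_(p : V * V | adj E p.1 p.2 && (enum_rank p.1 < enum_rank p.2)%N)
    frobenius_norm (sigma p.1 p.2 *m tau p.2 - tau p.1).

(* the set written C_T(V) *)
Definition constant_on T sigma : set (V -> 'M[R[i]]_d) :=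
  [set tau | unitary_valued tau /\
             forall u v, adj T u v -> sigma u v *m tau v = tau u].

End Signature.

Definition is_min (R : realType) (S : set R) (m : R) := S m /\ lbound S m.

Section Example.
Variables (R : realType) (r : R).

Definition vx : 'I_4 := @Ordinal 4 0 isT.
Definition vy : 'I_4 := @Ordinal 4 1 isT.
Definition vz : 'I_4 := @Ordinal 4 2 isT.
Definition vw : 'I_4 := @Ordinal 4 3 isT.

Definition edges : {set {set 'I_4}} :=
  [set [set vx; vy]; [set vy; vz]; [set vz; vw]; [set vw; vx];
       [set vy; vw]]%SET.

Definition mx22 (a b c e : R[i]) : 'M[R[i]]_2 :=
  \matrix_(i < 2, j < 2)
    if i == 0 then (if j == 0 then a else b) else (if j == 0 then c else e).

Definition cexp (t : R) : R[i] := cos t +i* sin t.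

Definition alpha (k : nat) : R := 2 * (k%:R - 1) * pi / 3.

Definition matA (k : nat) : 'M[R[i]]_2 :=
  mx22 (r%:C * cexp (alpha k))     (- (Num.sqrt (1 - r ^+ 2))%:C)
       (Num.sqrt (1 - r ^+ 2))%:C  (r%:C * cexp (- alpha k)).

Definition matB (k : nat) : 'M[R[i]]_2 := invmx (matA 3) *m matA k.

(* The default 1%:M gives the three edges with trivial signature; on pairs
   that are not edges it is a junk value. *)
Definition sigma (u v : 'I_4) : 'M[R[i]]_2 :=
  if (u, v) == (vx, vw) then matB 1
  else if (u, v) == (vw, vx) then invmx (matB 1)
  else if (u, v) == (vz, vw) then matB 2
  else if (u, v) == (vw, vz) then invmx (matB 2)
  else 1%:M.

End Example.

Section SignatureCheck.
Variables (R : realType) (r : R).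
Hypotheses (r_ge0 : 0 <= r) (r_le1 : r <= 1).

Lemma matA_unitary k : matA r k \is unitarymx.
Proof.
have hs : Num.sqrt (1 - r ^+ 2) ^+ 2 = 1 - r ^+ 2.
  by rewrite sqr_sqrtr // subr_ge0 expr_le1.
have hc := cos2Dsin2 (alpha R k).
apply/unitarymxP/matrixP => i j.
rewrite !mxE !big_ord_recl big_ord0 !mxE /=.
move: hs hc; set s := Num.sqrt _; set c := cos _; set t := sin _ => hs hc.
rewrite /cexp cosN sinN -/c -/t.
by case: i => [[|[|//]] ?]; case: j => [[|[|//]] ?] /=;
  apply/eqP; rewrite eq_complex /=; apply/andP; split; apply/eqP; nra.
Qed.

Lemma matB_unitary k : matB r k \is unitarymx.
Proof.
by rewrite /matB mul_unitarymx ?matA_unitary// invmx_unitary ?trmxC_unitary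
  ?matA_unitary.
Qed.

Lemma sigma_signature : is_signature edges (sigma r).
Proof.
have table (T : Type) (P : T -> bool) (f : T -> T) (o b1 b2 : T) :
    P o -> P b1 -> P b2 -> P (f b1) -> P (f b2) ->
    f o = o -> f (f b1) = b1 -> f (f b2) = b2 ->
    let s (u v : 'I_4) :=
      if (u, v) == (vx, vw) then b1
      else if (u, v) == (vw, vx) then f b1
      else if (u, v) == (vz, vw) then b2
      else if (u, v) == (vw, vz) then f b2
      else o in
    forall u v, P (s u v) /\ s v u = f (s u v).
  move=> Po P1 P2 Pf1 Pf2 fo f1 f2 s u v; rewrite {}/s.
  by case: u => [[|[|[|[|//]]]] ?]; case: v => [[|[|[|[|//]]]] ?];
    rewrite !xpair_eqE -!val_eqE /= ?Po ?P1 ?P2 ?Pf1 ?Pf2 ?f1 ?f2 ?fo.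
have U1 : 1%:M \is @unitarymx R[i] 2 2.
  by apply/unitarymxP; rewrite trmx1 map_mx1 mulmx1.
have UV k : invmx (matB r k) \is unitarymx.
  by rewrite invmx_unitary ?trmxC_unitary matB_unitary.
move=> u v _.
exact: (table _ (fun A => A \is unitarymx) (@invmx R[i] 2) 1%:M (matB r 1)
  (matB r 2) U1 (matB_unitary 1) (matB_unitary 2) (UV 1%N) (UV 2%N)
  (invmx1 _ 2) (invmxK _) (invmxK _)).
Qed.

End SignatureCheck.

(* Main.v *)
Require Import Defs.
From mathcomp Require Import ring lra.

Set Implicit Arguments.
Unset Strict Implicit.
Import Order.TTheory GRing.Theory Num.Theory.
Import numFieldNormedType.Exports.

Local Open Scope classical_set_scope.
Local Open Scope ring_scope.
Local Open Scope sesquilinear_scope.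

(** Write [X, Y, Z, W] for the values of [tau] at the four vertices,
    [B_k = A_3^-1 A_k] (so that [B_3 = 1]) and [C_k = B_k W].  The frustration is
    [|Y - X| + |Z - Y| + |C_1 - X| + |C_2 - Z| + |C_3 - Y|]: three matrices
    [C_1, C_3, C_2] are linked to the path [X - Y - Z].

    Since the angles [alpha_k] are spread evenly over the circle and the
    Frobenius norm is unitarily invariant, the [C_k] are the vertices of an
    equilateral triangle of side [sqrt 6 * r] ([matB_distance]).  A spanning
    tree joins [y] to [w] by the edge [yw] or through [x] or [z]
    ([spanning_tree_yw]); in each case two sides of the triangle are covered
    by disjoint groups of edges, so a tree costs at least [2 * sqrt 6 * r]
    ([two_distances_le], [spanning_tree_frustration]).

    It is cheaper to give [X = Y = Z] the value, up to the left factor [A_3^-1],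
    of the quarter turn [J], the unitary part of the centroid
    [sqrt (1 - r ^ 2) * J] of the [A_k].  With [s = sqrt (1 - r ^ 2)], each [A_k]
    is at distance [2 * sqrt (1 - s)] from [J], and the total
    [6 * sqrt (1 - s)] ([frustration_center]) is below [2 * sqrt 6 * r] exactly
    when [s > 1 / 2], that is [r < sqrt 3 / 2 = 0.866...] ([center_lt_tree]).

    The minimum over all unitary-valued [tau] is attained because these form a
    compact set on which the frustration is continuous
    ([frustration_min_attained]); there are only finitely many trees, and the
    star centred at [y] is one of them. *)

(** * The Frobenius norm *)

Section FrobeniusNorm.
Variable R : realType.
Local Notation normc := ComplexField.Normc.normc.

Lemma frobenius_norm_ge0 m n (A : 'M[R[i]%C]_(m, n)) : 0 <= frobenius_norm A.
Proof. exact: sqrtr_ge0. Qed.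

Lemma normc_sqrE (z : R[i]%C) :
  normc z ^+ 2 = complex.Re z ^+ 2 + complex.Im z ^+ 2.
Proof. by case: z => a b; rewrite /= sqr_sqrtr // addr_ge0 ?sqr_ge0. Qed.

Lemma sqr_frobenius_norm m n (A : 'M[R[i]%C]_(m, n)) :
  frobenius_norm A ^+ 2 =
  \sum_(i < m) \sum_(j < n) (complex.Re (A i j) ^+ 2 + complex.Im (A i j) ^+ 2).
Proof.
rewrite sqr_sqrtr ?sumr_ge0 // => [|i _]; last first.
  by rewrite sumr_ge0 // => j _; exact: sqr_ge0.
by apply: eq_bigr => i _; apply: eq_bigr => j _; rewrite normc_sqrE.
Qed.

Lemma frobenius_norm0 m n : frobenius_norm (0 : 'M[R[i]%C]_(m, n)) = 0.
Proof.
apply/eqP; rewrite -sqrf_eq0 sqr_frobenius_norm; apply/eqP.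
by rewrite big1 // => i _; rewrite big1 // => j _; rewrite mxE /= expr0n addr0.
Qed.

Lemma frobenius_norm_eq0 m n (A : 'M[R[i]%C]_(m, n)) :
  frobenius_norm A = 0 -> A = 0.
Proof.
move=> A0; have := sqr_frobenius_norm A; rewrite A0 expr0n /= => /esym sum0.
have sqr2_ge0 (z : R[i]%C) : 0 <= complex.Re z ^+ 2 + complex.Im z ^+ 2.
  by rewrite addr_ge0 ?sqr_ge0.
apply/matrixP => i j; rewrite mxE; apply: ComplexField.Normc.eq0_normc.
apply/eqP; rewrite -sqrf_eq0 normc_sqrE; apply/eqP.
have row0 := psumr_eq0P (fun i _ => sumr_ge0 _ (fun j _ => sqr2_ge0 (A i j))) sum0.
exact: psumr_eq0P (fun j _ => sqr2_ge0 (A i j)) (row0 i isT) j isT.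
Qed.

(** Through this formula [U *m U^t* = 1] cancels inside the trace, which gives the
    unitary invariance on both sides. *)
Lemma frobenius_trace m n (A : 'M[R[i]%C]_(m, n)) :
  ((frobenius_norm A ^+ 2)%:C)%C = \tr (A *m A ^t*).
Proof.
rewrite sqr_frobenius_norm /mxtrace rmorph_sum; apply: eq_bigr => i _ /=.
rewrite rmorph_sum mxE; apply: eq_bigr => j _ /=.
rewrite !mxE; case: (A i j) => a b.
by apply/eqP; rewrite eq_complex /=; apply/andP; split; apply/eqP; ring.
Qed.

Lemma frobenius_norm_trace m n p q (A : 'M[R[i]%C]_(m, n)) (B : 'M[R[i]%C]_(p, q)) :
  \tr (A *m A ^t*) = \tr (B *m B ^t*) -> frobenius_norm A = frobenius_norm B.
Proof.
rewrite -!frobenius_trace => /(congr1 (@complex.Re R)) /= /eqP.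
by rewrite eqrXn2 ?frobenius_norm_ge0 // => /eqP.
Qed.

Lemma frobenius_normMr m n (A : 'M[R[i]%C]_(m, n)) (U : 'M[R[i]%C]_n) :
  U \is unitarymx -> frobenius_norm (A *m U) = frobenius_norm A.
Proof.
move=> uU; apply: frobenius_norm_trace.
by rewrite trmx_mul map_mxM /= mulmxA mulmxtVK.
Qed.

Lemma frobenius_normMl m n (U : 'M[R[i]%C]_m) (A : 'M[R[i]%C]_(m, n)) :
  U \is unitarymx -> frobenius_norm (U *m A) = frobenius_norm A.
Proof.
move=> uU; apply: frobenius_norm_trace.
rewrite trmx_mul map_mxM /= mxtrace_mulC -mulmxA [U ^t* *m _]mulmxA.
rewrite -invmx_unitary // mulVmx ?unitarymx_unit // mul1mx.
by rewrite mxtrace_mulC.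
Qed.

Lemma frobenius_normN m n (A : 'M[R[i]%C]_(m, n)) :
  frobenius_norm (- A) = frobenius_norm A.
Proof.
congr Num.sqrt; apply: eq_bigr => i _; apply: eq_bigr => j _.
by rewrite mxE !normc_sqrE; case: (A i j) => a b /=; rewrite !sqrrN.
Qed.

(** Minkowski's inequality for the real coordinates of the entries: the form
    [|x A + y B| ^ 2] in the real unknowns [x, y] is nonnegative, which bounds its
    middle coefficient (Cauchy-Schwarz). *)
Lemma frobenius_normD m n (A B : 'M[R[i]%C]_(m, n)) :
  frobenius_norm (A + B) <= frobenius_norm A + frobenius_norm B.
Proof.
pose dot (C D : 'M[R[i]%C]_(m, n)) : R := \sum_i \sum_j
  (complex.Re (C i j) * complex.Re (D i j) + complex.Im (C i j) * complex.Im (D i j)).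
have dotxx C : frobenius_norm C ^+ 2 = dot C C.
  rewrite sqr_frobenius_norm; apply: eq_bigr => i _; apply: eq_bigr => j _.
  by rewrite !expr2.
have expand a b : \sum_i \sum_j
    ((a * complex.Re (A i j) + b * complex.Re (B i j)) ^+ 2 +
     (a * complex.Im (A i j) + b * complex.Im (B i j)) ^+ 2) =
    a ^+ 2 * dot A A + 2 * a * b * dot A B + b ^+ 2 * dot B B.
  rewrite /dot !mulr_sumr -!big_split; apply: eq_bigr => i _ /=.
  rewrite !mulr_sumr -!big_split; apply: eq_bigr => j _ /=; ring.
have sqr_normD : frobenius_norm (A + B) ^+ 2 = dot A A + 2 * dot A B + dot B B.
  have := expand 1 1; rewrite !expr1n !mul1r !mulr1 => <-.
  rewrite sqr_frobenius_norm; apply: eq_bigr => i _; apply: eq_bigr => j _.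
  by rewrite mxE !mul1r; case: (A i j) (B i j) => [? ?] [? ?].
have pos a b : 0 <= a ^+ 2 * dot A A + 2 * a * b * dot A B + b ^+ 2 * dot B B.
  rewrite -expand sumr_ge0 // => i _; rewrite sumr_ge0 // => j _.
  by rewrite addr_ge0 ?sqr_ge0.
move: (frobenius_norm_ge0 A) (frobenius_norm_ge0 B) sqr_normD pos.
rewrite -!dotxx; set a := frobenius_norm A; set b := frobenius_norm B.
move: (dot A B) => c a0 b0 sqr_normD pos.
suff cab : c <= a * b.
  rewrite -(ler_pXn2r (_ : 0 < 2)%N) ?nnegrE ?addr_ge0 ?frobenius_norm_ge0 //.
  by rewrite sqr_normD; nra.
(* The form a^2 x^2 + 2 c x y + b^2 y^2 is nonnegative.  At (b, - a) it equals
   2 a b (a b - c), which settles the case a b > 0; when a = 0 (resp. b = 0) the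
   chosen point gives - c^2 (b^2 + 2) (resp. - c^2 (a^2 + 2)), hence c = 0. *)
have [a00|an0] := eqVneq a 0.
  have := pos (- (b ^+ 2 + 1)) c.
  suff -> : (- (b ^+ 2 + 1)) ^+ 2 * a ^+ 2 + 2 * (- (b ^+ 2 + 1)) * c * c
      + c ^+ 2 * b ^+ 2 = - (c ^+ 2 * (b ^+ 2 + 2)).
    rewrite oppr_ge0 pmulr_lle0 ?ltr_wpDl ?sqr_ge0 // => c2.
    by rewrite a00 mul0r; have := sqr_ge0 c; nra.
  by rewrite a00; ring.
have [b00|bn0] := eqVneq b 0.
  have := pos c (- (a ^+ 2 + 1)).
  suff -> : c ^+ 2 * a ^+ 2 + 2 * c * (- (a ^+ 2 + 1)) * c
      + (- (a ^+ 2 + 1)) ^+ 2 * b ^+ 2 = - (c ^+ 2 * (a ^+ 2 + 2)).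
    rewrite oppr_ge0 pmulr_lle0 ?ltr_wpDl ?sqr_ge0 // => c2.
    by rewrite b00 mulr0; have := sqr_ge0 c; nra.
  by rewrite b00; ring.
have ab_gt0 : 0 < a * b by rewrite mulr_gt0 // lt0r ?an0 ?bn0.
have := pos b (- a).
have -> : b ^+ 2 * a ^+ 2 + 2 * b * - a * c + (- a) ^+ 2 * b ^+ 2
    = 2 * (a * b * (a * b - c)) by ring.
by rewrite pmulr_rge0 // pmulr_rge0 // subr_ge0.
Qed.

Lemma frobenius_distC m n (A B : 'M[R[i]%C]_(m, n)) :
  frobenius_norm (A - B) = frobenius_norm (B - A).
Proof. by rewrite -frobenius_normN opprB. Qed.

Lemma frobenius_distD m n (A B C : 'M[R[i]%C]_(m, n)) :
  frobenius_norm (A - C) <= frobenius_norm (A - B) + frobenius_norm (B - C).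
Proof. by rewrite -(subrKA B) frobenius_normD. Qed.

End FrobeniusNorm.

(** * Existence of the minimum of the frustration *)

Section ComplexContinuity.
Variables (R : realType) (T : topologicalType).
Implicit Types f g : T -> R[i]%C.

(** Stated on real and imaginary parts, so that the extreme value theorem, the
    compactness of segments and the continuity of [Num.sqrt] apply to functions
    with values in [R]. *)
Definition ccontinuous f :=
  continuous (fun x => complex.Re (f x)) /\ continuous (fun x => complex.Im (f x)).

Lemma ccontinuous_cst (c : R[i]%C) : ccontinuous (fun=> c).
Proof. by split => x; exact: cvg_cst. Qed.

Lemma ccontinuousD f g :
  ccontinuous f -> ccontinuous g -> ccontinuous (fun x => f x + g x).
Proof.
move=> [fr fi] [gr gi]; split => x.
- under eq_fun do rewrite raddfD /=.
  by apply: cvgD; [exact: fr|exact: gr].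
- under eq_fun do rewrite raddfD /=.
  by apply: cvgD; [exact: fi|exact: gi].
Qed.

Lemma ccontinuousN f : ccontinuous f -> ccontinuous (fun x => - f x).
Proof.
move=> [fr fi]; split => x; under eq_fun do rewrite raddfN /=.
- by apply: cvgN; exact: fr.
- by apply: cvgN; exact: fi.
Qed.

Lemma ccontinuousM f g :
  ccontinuous f -> ccontinuous g -> ccontinuous (fun x => f x * g x).
Proof.
move=> [fr fi] [gr gi]; split => x.
- rewrite (_ : (fun _ => _) = fun x => complex.Re (f x) * complex.Re (g x) -
      complex.Im (f x) * complex.Im (g x)); last first.
    by apply/funext => t; case: (f t) (g t) => [? ?] [? ?].
  by apply: cvgB; apply: cvgM; [exact: fr|exact: gr|exact: fi|exact: gi].
- rewrite (_ : (fun _ => _) = fun x => complex.Re (f x) * complex.Im (g x) +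
      complex.Im (f x) * complex.Re (g x)); last first.
    by apply/funext => t; case: (f t) (g t) => [? ?] [? ?].
  by apply: cvgD; apply: cvgM; [exact: fr|exact: gi|exact: fi|exact: gr].
Qed.

Lemma ccontinuous_conj f : ccontinuous f -> ccontinuous (fun x => (f x)^*).
Proof.
move=> [fr fi]; split => x.
- rewrite (_ : (fun _ => _) = fun x => complex.Re (f x)); first exact: fr.
  by apply/funext => t; case: (f t).
- rewrite (_ : (fun _ => _) = fun x => - complex.Im (f x)).
    by apply: cvgN; exact: fi.
  by apply/funext => t; case: (f t).
Qed.

Lemma ccontinuous_sum (I : Type) (s : seq I) (F : I -> T -> R[i]%C) :
  (forall i, ccontinuous (F i)) -> ccontinuous (fun x => \sum_(i <- s) F i x).
Proof.
move=> cF; elim: s => [|i s IHs].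
  by under eq_fun do rewrite big_nil; exact: ccontinuous_cst.
by under eq_fun do rewrite big_cons; exact: ccontinuousD.
Qed.

Definition mxcontinuous m n (F : T -> 'M[R[i]%C]_(m, n)) :=
  forall i j, ccontinuous (fun x => F x i j).

Lemma mxcontinuous_cst m n (A : 'M[R[i]%C]_(m, n)) : mxcontinuous (fun=> A).
Proof. by move=> i j; exact: ccontinuous_cst. Qed.

Lemma mxcontinuousB m n (F G : T -> 'M[R[i]%C]_(m, n)) :
  mxcontinuous F -> mxcontinuous G -> mxcontinuous (fun x => F x - G x).
Proof.
move=> cF cG i j; under eq_fun do rewrite !mxE.
by apply: ccontinuousD => //; exact: ccontinuousN.
Qed.

Lemma mxcontinuousM m n p (F : T -> 'M[R[i]%C]_(m, n)) (G : T -> 'M[R[i]%C]_(n, p)) :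
  mxcontinuous F -> mxcontinuous G -> mxcontinuous (fun x => F x *m G x).
Proof.
move=> cF cG i j; under eq_fun do rewrite mxE.
by apply: ccontinuous_sum => k; exact: ccontinuousM.
Qed.

Lemma mxcontinuous_adjoint m n (F : T -> 'M[R[i]%C]_(m, n)) :
  mxcontinuous F -> mxcontinuous (fun x => (F x)^t*).
Proof.
move=> cF i j; under eq_fun do rewrite !mxE.
exact: ccontinuous_conj.
Qed.

Lemma continuous_sumr (I : Type) (s : seq I) (P : pred I) (F : I -> T -> R) :
  (forall i, P i -> continuous (F i)) ->
  continuous (fun x => \sum_(i <- s | P i) F i x).
Proof. by apply: continuous_big => x; apply: cvgD; [exact: cvg_fst|exact: cvg_snd]. Qed.

Lemma continuous_frobenius_norm m n (F : T -> 'M[R[i]%C]_(m, n)) :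
  mxcontinuous F -> continuous (fun x => frobenius_norm (F x)).
Proof.
move=> cF x; apply: (@continuous_comp _ _ _ _ Num.sqrt); last exact: sqrt_continuous.
move: x; apply: continuous_sumr => i _; apply: continuous_sumr => j _ x.
under eq_fun do rewrite normc_sqrE.
have [fr fi] := cF i j.
by apply: cvgD; under eq_fun do rewrite expr2; apply: cvgM; (exact: fr || exact: fi).
Qed.

(** The preimage of [0] under the continuous function [|F F^t* - 1|]. *)
Lemma closed_unitary m n (F : T -> 'M[R[i]%C]_(m, n)) :
  mxcontinuous F -> closed [set x | F x \is unitarymx].
Proof.
move=> cF; pose G x := F x *m (F x)^t* - 1%:M.
have cG : continuous (fun x => frobenius_norm (G x)).
  apply: continuous_frobenius_norm; apply: mxcontinuousB (mxcontinuous_cst _).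
  by apply: mxcontinuousM => //; exact: mxcontinuous_adjoint.
rewrite (_ : [set _ | _] = (fun x => frobenius_norm (G x)) @^-1` [set x | x = 0]).
  by apply: preimage_closed; [move=> x _; exact: cG|exact: closed_eq].
apply/seteqP; split => x /=.
  by move=> /unitarymxP e; rewrite /G e subrr frobenius_norm0.
by move=> /frobenius_norm_eq0 /subr0_eq /unitarymxP.
Qed.

End ComplexContinuity.

Section Attained.
Variables (R : realType) (V : finType) (d : nat).

(* The real and imaginary parts of all entries of [tau], with the product
   topology: Tychonoff's theorem then applies to boxes. *)
Local Notation coordinates := (prod_topology (fun _ : V * 'I_d * 'I_d * bool => R)).

Definition decode (f : coordinates) (v : V) : 'M[R[i]%C]_d :=
  \matrix_(i, j) (f (v, i, j, false) +i* f (v, i, j, true))%C.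

Lemma mxcontinuous_decode v : mxcontinuous (decode ^~ v).
Proof.
have cproj k : continuous (fun f : coordinates => f k).
  exact: (@proj_continuous _ (fun _ : V * 'I_d * 'I_d * bool => R) k).
move=> i j; split.
- rewrite (_ : (fun _ => _) = fun f : coordinates => f (v, i, j, false)) //.
  by apply/funext => f; rewrite mxE.
- rewrite (_ : (fun _ => _) = fun f : coordinates => f (v, i, j, true)) //.
  by apply/funext => f; rewrite mxE.
Qed.

Lemma decode_surj (tau : V -> 'M[R[i]%C]_d) : exists f, decode f = tau.
Proof.
exists (fun k => let: (v, i, j, b) := k in
  if b then complex.Im (tau v i j) else complex.Re (tau v i j)).
by apply/funext => v; apply/matrixP => i j; rewrite mxE /=; case: (tau v i j).
Qed.

(** The rows of a unitary matrix have norm 1. *)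
Lemma unitary_entry_le1 (U : 'M[R[i]%C]_d) i j : U \is unitarymx ->
  complex.Re (U i j) ^+ 2 + complex.Im (U i j) ^+ 2 <= 1.
Proof.
move=> /unitarymxP /matrixP /(_ i i) /(congr1 (@complex.Re R)).
rewrite !mxE eqxx /= raddf_sum /= => <-.
rewrite (bigD1 j) //= !mxE.
have e (z : R[i]%C) :
    complex.Re (z * z^*) = complex.Re z ^+ 2 + complex.Im z ^+ 2.
  by case: z => a b /=; ring.
rewrite e lerDl sumr_ge0 // => k _.
by rewrite !mxE e addr_ge0 ?sqr_ge0.
Qed.

(** A closed subset of the cube of all coordinates in [[-1, 1]]. *)
Lemma compact_unitary_valued :
  compact [set f : coordinates | unitary_valued (decode f)].
Proof.
apply: (@subclosed_compact _ _ [set f : coordinates | forall k, `[-1, 1]%classic (f k)]).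
- rewrite (_ : [set _ | _] =
      \bigcap_(v in [set: V]) [set f | decode f v \is unitarymx]).
    by apply: closed_bigI => v _; apply: closed_unitary; exact: mxcontinuous_decode.
  by apply/seteqP; split => f /= uf v; [move=> _|]; exact: uf.
- exact: (@tychonoff _ (fun=> R) (fun=> `[-1, 1]%classic)
    (fun=> @segment_compact R (-1) 1)).
- move=> f /= uf [[[v i] j] b]; have := unitary_entry_le1 i j (uf v).
  rewrite mxE /= => entry_le1.
  rewrite in_itv /= -ler_norml -(@expr_le1 _ 2) // real_normK ?num_real //.
  by case: b; apply: le_trans entry_le1; rewrite ?lerDl ?lerDr sqr_ge0.
Qed.

Lemma frustration_min_attained E (sigma : V -> V -> 'M[R[i]%C]_d) :
  exists2 tau, unitary_valued tau &
    forall tau', unitary_valued tau' ->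
      frustration E sigma tau <= frustration E sigma tau'.
Proof.
pose A := [set f : coordinates | unitary_valued (decode f)].
pose F (f : coordinates) := frustration E sigma (decode f).
have A_neq0 : A !=set0.
  have [f e] := decode_surj (fun=> 1%:M).
  by exists f => v; rewrite e; apply/unitarymxP; rewrite trmx1 map_mx1 mulmx1.
have cF : continuous F.
  apply: continuous_sumr => p _; apply: continuous_frobenius_norm.
  apply: mxcontinuousB; last exact: mxcontinuous_decode.
  exact: mxcontinuousM (mxcontinuous_cst _ _) (mxcontinuous_decode _).
have [f /set_mem uf fmin] := compact_EVT_min A_neq0 compact_unitary_valued
  (continuous_subspaceT cF).
exists (decode f) => // tau' utau'.
have [f' e] := decode_surj tau'; rewrite -e.
by apply: fmin; apply: mem_set; rewrite /A /= e.
Qed.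

End Attained.

(** * Spanning trees of the graph *)

Lemma set2_eq (V : finType) (a b c d : V) :
  ([set a; b]%SET == [set c; d]%SET) =
  [&& (a == c) || (a == d), (b == c) || (b == d),
      (c == a) || (c == b) & (d == a) || (d == b)].
Proof. by rewrite finset.eqEsubset !finset.subUset !finset.sub1set !inE -!andbA. Qed.

Lemma adj_sym (V : finType) (E : {set {set V}}) : symmetric (adj E).
Proof. by move=> u v; rewrite /adj /= eq_sym finset.setUC. Qed.

(** The graph is the complete graph on four vertices without the edge [xz]. *)
Lemma adj_edgesE (u v : 'I_4) :
  adj edges u v = (u != v) && ([set u; v]%SET != [set vx; vz]%SET).
Proof.
rewrite /adj /edges /= !inE !set2_eq -!val_eqE.
by case: u => [[|[|[|[|//]]]] ?]; case: v => [[|[|[|[|//]]]] ?].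
Qed.

Definition star : {set {set 'I_4}} :=
  [set [set vx; vy]; [set vy; vz]; [set vy; vw]]%SET.

Lemma adj_starE (u v : 'I_4) : adj star u v = (u != v) && ((u == vy) || (v == vy)).
Proof.
rewrite /adj /star /= !inE !set2_eq -!val_eqE.
by case: u => [[|[|[|[|//]]]] ?]; case: v => [[|[|[|[|//]]]] ?].
Qed.

(** In a star, one of any two consecutive vertices of a cycle is the centre, so a
    cycle of length at least 3 would visit the centre twice. *)
Lemma star_spanning_tree : spanning_tree edges star.
Proof.
split.
- apply/fintype.subsetP => e; rewrite !inE => /orP[/orP[]|] /eqP ->;
    by rewrite eqxx ?orbT.
- move=> u v; have toy w : connect (adj star) w vy /\ connect (adj star) vy w.
    have [->|wy] := eqVneq w vy; first by split; exact: connect0.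
    by split; apply: connect1; rewrite adj_starE ?[vy == w]eq_sym wy eqxx ?orbT.
  exact: connect_trans (toy u).1 (toy v).2.
- move=> [|a [|b [|c s]]] // _ /andP[] /= /and3P[ab bc sa].
  rewrite !inE !negb_or -!andbA => /and5P[ab' ac' _ bc' /andP[bs _]].
  rewrite !adj_starE in ab bc.
  have [/eqP ay|/eqP biy] := orP (andP ab).2.
    subst a; move: (andP bc).2.
    by rewrite ![_ == vy]eq_sym (negPf ab') (negPf ac').
  subst b; move: sa; case: s bs {bc ab} => [|d s] /=.
    by rewrite andbT adj_starE [c == vy]eq_sym (negPf bc') (negPf ab') andbF.
  rewrite inE negb_or => /andP[bd _] /andP[].
  by rewrite adj_starE [c == vy]eq_sym [d == vy]eq_sym (negPf bc') (negPf bd) andbF.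
Qed.

(** If all three ways from [y] to [w] were cut, then [y] and those of [x], [z] that
    are joined to [y] would form a union of components that misses [w]. *)
Lemma spanning_tree_yw T : spanning_tree edges T ->
  [\/ adj T vy vw, adj T vx vy && adj T vx vw | adj T vy vz && adj T vz vw].
Proof.
move=> [TE Tconn _].
case ayw: (adj T vy vw); first by constructor 1.
case axyw: (adj T vx vy && adj T vx vw); first by constructor 2.
case ayzw: (adj T vy vz && adj T vz vw); first by constructor 3.
pose a : {pred 'I_4} := [pred v | [|| v == vy,
  (v == vx) && adj T vx vy | (v == vz) && adj T vy vz]].
suff acl : fingraph.closed (adj T) a.
  by have := closed_connect acl (Tconn vy vw); rewrite !inE -!val_eqE.
apply: (intro_closed (sym_connect_sym (@adj_sym _ T))) => u v uv.
have vxzF : adj T vx vz = false.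
  apply/negP => /andP[_ /(fintype.subsetP TE)].
  by rewrite !inE !set2_eq -!val_eqE.
have cases (w : 'I_4) : [\/ w = vx, w = vy, w = vz | w = vw].
  case: w => [[|[|[|[|//]]]] ?];
  [constructor 1|constructor 2|constructor 3|constructor 4]; exact: val_inj.
rewrite !inE.
move: uv; case: (cases u) => ->; case: (cases v) => -> uv;
  rewrite -!val_eqE /= ?orbF ?andbT //=.
all: move: uv ayw axyw ayzw vxzF.
all: rewrite ?(@adj_sym _ T vy vx) ?(@adj_sym _ T vz vx).
all: by case: (adj T vx vy); case: (adj T vx vz); case: (adj T vx vw);
  case: (adj T vy vz); case: (adj T vy vw); case: (adj T vz vw).
Qed.

(** * The two sides of the inequality *)

(** Here [W, C1, C2] is an equilateral triangle.  In each alternative the terms that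
    remain contain two disjoint chains, each of which joins two vertices of the
    triangle. *)
Lemma two_distances_le (R : realType) m n (X Y Z W C1 C2 : 'M[R[i]%C]_(m, n)) e :
  frobenius_norm (C1 - W) = e -> frobenius_norm (C2 - W) = e ->
  frobenius_norm (C1 - C2) = e ->
  [\/ W = Y, Y = X /\ C1 = X | Z = Y /\ C2 = Z] ->
  2 * e <= frobenius_norm (Y - X) + frobenius_norm (Z - Y) +
    frobenius_norm (C1 - X) + frobenius_norm (C2 - Z) + frobenius_norm (W - Y).
Proof.
move=> d1 d2 d12 [eW|[eY eC]|[eZ eC]].
- subst W; have := frobenius_distD C1 X Y; have := frobenius_distD C2 Z Y.
  rewrite d1 d2 (frobenius_distC X Y) subrr frobenius_norm0.
  lra.
- subst Y C1; have := frobenius_distD X Z C2.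
  rewrite d12 (frobenius_distC X Z) (frobenius_distC Z C2) (frobenius_distC W X) d1.
  rewrite subrr frobenius_norm0; lra.
- subst Z C2; have := frobenius_distD C1 X Y.
  rewrite d12 (frobenius_distC X Y) (frobenius_distC W Y) d2.
  rewrite subrr frobenius_norm0; lra.
Qed.

Lemma sum_I4 (M : nmodType) (f : 'I_4 -> M) :
  \sum_i f i = f vx + f vy + f vz + f vw.
Proof.
rewrite !big_ord_recl big_ord0 addr0 !addrA.
by congr (f _ + f _ + f _ + f _); exact: val_inj.
Qed.

Section Values.
Variables (R : realType) (r : R).
Local Notation s := (Num.sqrt (1 - r ^+ 2)).

Lemma frustration_edgesE (tau : 'I_4 -> 'M[R[i]%C]_2) :
  frustration edges (sigma r) tau =
    frobenius_norm (tau vy - tau vx) + frobenius_norm (tau vz - tau vy) +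
    frobenius_norm (matB r 1 *m tau vw - tau vx) +
    frobenius_norm (matB r 2 *m tau vw - tau vz) +
    frobenius_norm (tau vw - tau vy).
Proof.
pose F u v := frobenius_norm (sigma r u v *m tau v - tau u).
have rankE (u : 'I_4) : enum_rank u = u :> nat by rewrite enum_rank_ord.
transitivity (\sum_u \sum_v if adj edges u v && (u < v)%N then F u v else 0).
  rewrite pair_big -big_mkcond; apply: eq_bigl => p.
  by rewrite !rankE.
rewrite !sum_I4 !adj_edgesE !set2_eq -!val_eqE /= !add0r !addr0 /F /sigma.
rewrite !xpair_eqE -!val_eqE /= !mul1mx.
ring.
Qed.

Lemma frustration_constant (tau : 'I_4 -> 'M[R[i]%C]_2) M :
  tau vx = M -> tau vy = M -> tau vz = M ->
  frustration edges (sigma r) tau =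
    frobenius_norm (matB r 1 *m tau vw - M) +
    frobenius_norm (matB r 2 *m tau vw - M) + frobenius_norm (tau vw - M).
Proof.
by rewrite frustration_edgesE => -> -> ->; rewrite subrr frobenius_norm0 !add0r.
Qed.

(** The tripling formula gives [(c - 1) * (2 c + 1) ^ 2 = 0] for this cosine [c], and
    [c <> 1]. *)
Lemma cos_2pi3 : cos (2 * pi / 3) = - (1 / 2) :> R.
Proof.
set t := 2 * pi / 3.
have pi0 := pi_gt0 R.
have t0 : 0 < t by rewrite /t; lra.
have tpi : t <= pi by rewrite /t; lra.
have c3 : cos (t + t + t) = 1.
  by rewrite -[RHS](@cos2pi R); congr cos; rewrite /t; field.
have c1 : cos t != 1.
  apply/eqP => c1; have := @cos_inj R t 0.
  rewrite !in_itv /= (ltW t0) tpi lexx ltW // cos0 c1 => /(_ isT isT erefl).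
  by move=> t00; rewrite t00 ltxx in t0.
have := cos2Dsin2 t; move: c3; rewrite !cosD !sinD.
move: (cos t) (sin t) c1 => c u c1; set cos3 := (X in X = 1) => c3 cu.
have u2 : u ^+ 2 = 1 - c ^+ 2 by rewrite -cu; ring.
have e : (c - 1) * (2 * c + 1) ^+ 2 = 0.
  by transitivity (cos3 - 1); [rewrite /cos3; ring: u2|rewrite c3 subrr].
move/eqP: e; rewrite mulf_eq0 subr_eq0 (negPf c1) sqrf_eq0 /= => /eqP; lra.
Qed.

Lemma sqr_frobenius_matAB k l :
  frobenius_norm (matA r k - matA r l) ^+ 2 =
  4 * r ^+ 2 * (1 - cos (alpha R k - alpha R l)).
Proof.
rewrite sqr_frobenius_norm !big_ord_recl !big_ord0 !mxE /=.
rewrite !cosN !sinN cosB.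
have := cos2Dsin2 (alpha R k); have := cos2Dsin2 (alpha R l).
move: (cos _) (sin _) (cos _) (sin _) => cl sl ck sk hl hk.
have sl2 : sl ^+ 2 = 1 - cl ^+ 2 by rewrite -hk; ring.
have sk2 : sk ^+ 2 = 1 - ck ^+ 2 by rewrite -hl; ring.
ring: sl2 sk2.
Qed.

Lemma matA_equidistant k l : (0 < k < l)%N -> (l < 4)%N ->
  frobenius_norm (matA r k - matA r l) ^+ 2 = 6 * r ^+ 2.
Proof.
move=> kl l4; rewrite sqr_frobenius_matAB.
suff -> : cos (alpha R k - alpha R l) = - (1 / 2) by field.
rewrite -cosN -cos_2pi3.
case: k l l4 kl => [|[|[|[|k]]]] [|[|[|[|l]]]] //= _ _.
- by congr cos; rewrite /alpha; field.
- transitivity (cos (pi *+ 2 - 2 * pi / 3) : R).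
    by congr cos; rewrite /alpha; field.
  by rewrite cosB cos2pi sin2pi mul1r mul0r addr0.
- by congr cos; rewrite /alpha; field.
Qed.

(** The unitary factor of the centroid of the [matA r k]. *)
Definition rotJ : 'M[R[i]%C]_2 := mx22 0 (-1) 1 0.

Lemma rotJ_unitary : rotJ \is unitarymx.
Proof.
apply/unitarymxP/matrixP => i j; rewrite !mxE !big_ord_recl big_ord0 !mxE /=.
case: i => [[|[|//]] ?]; case: j => [[|[|//]] ?] /=;
  by apply/eqP; rewrite eq_complex /=; apply/andP; split; apply/eqP; ring.
Qed.

Lemma sqr_frobenius_matA_rotJ k : r ^+ 2 <= 1 ->
  frobenius_norm (matA r k - rotJ) ^+ 2 = 4 * (1 - s).
Proof.
move=> r1; rewrite sqr_frobenius_norm !big_ord_recl !big_ord0 !mxE /=.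
rewrite !cosN !sinN.
have : s ^+ 2 = 1 - r ^+ 2 by rewrite sqr_sqrtr // subr_ge0.
have := cos2Dsin2 (alpha R k).
move: (s) (cos _) (sin _) => q c t ct q2.
have t2 : t ^+ 2 = 1 - c ^+ 2 by rewrite -ct; ring.
ring: t2 q2.
Qed.

Hypotheses (r_ge0 : 0 <= r) (r_le1 : r <= 1).

Lemma sqr_r_le1 : r ^+ 2 <= 1. Proof. by rewrite expr_le1. Qed.

(** The difference is [matA r k - matA r l] between two unitary factors. *)
Lemma matB_distance k l (W : 'M[R[i]%C]_2) : W \is unitarymx ->
  (0 < k < l)%N -> (l < 4)%N ->
  frobenius_norm (matB r k *m W - matB r l *m W) = Num.sqrt (6 * r ^+ 2).
Proof.
move=> uW kl l4; rewrite -mulmxBl /matB -mulmxBr frobenius_normMr //.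
rewrite frobenius_normMl; last by rewrite invmx_unitary ?trmxC_unitary matA_unitary.
by rewrite -(matA_equidistant kl l4) sqrtr_sqr ger0_norm ?frobenius_norm_ge0.
Qed.

Lemma matB3 : matB r 3 = 1%:M.
Proof. by rewrite /matB mulVmx // unitarymx_unit // matA_unitary. Qed.

Lemma spanning_tree_frustration T tau : spanning_tree edges T ->
  constant_on T (sigma r) tau ->
  2 * Num.sqrt (6 * r ^+ 2) <= frustration edges (sigma r) tau.
Proof.
move=> Ttree [utau tauT]; rewrite frustration_edgesE.
have d13 := matB_distance (utau vw) (isT : (0 < 1 < 3)%N) isT.
have d23 := matB_distance (utau vw) (isT : (0 < 2 < 3)%N) isT.
have d12 := matB_distance (utau vw) (isT : (0 < 1 < 2)%N) isT.
rewrite matB3 mul1mx in d13 d23.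
have trivial_edge u v : adj T u v -> sigma r u v = 1%:M -> tau v = tau u.
  by move=> /tauT + e; rewrite e mul1mx.
apply: two_distances_le d13 d23 d12 _.
case: (spanning_tree_yw Ttree) => [yw|/andP[xy xw]|/andP[yz zw]].
- by constructor 1; exact: trivial_edge yw erefl.
- by constructor 2; split; [exact: trivial_edge xy erefl|exact: tauT xw].
- by constructor 3; split; [exact: trivial_edge yz erefl|exact: tauT zw].
Qed.

(** Constant on [x, y, z], which makes [xy] and [yz] free; the constant is [rotJ]
    moved by [A_3^-1], at the same distance from the three [matB r k]. *)
Definition center (v : 'I_4) : 'M[R[i]%C]_2 :=
  if v == vw then 1%:M else invmx (matA r 3) *m rotJ.

Lemma center_unitary : unitary_valued center.
Proof.
move=> v; rewrite /center; case: ifP => _.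
  by apply/unitarymxP; rewrite trmx1 map_mx1 mulmx1.
by rewrite mul_unitarymx ?rotJ_unitary // invmx_unitary ?trmxC_unitary matA_unitary.
Qed.

Lemma frustration_center :
  frustration edges (sigma r) center = 3 * Num.sqrt (4 * (1 - s)).
Proof.
have dist k : frobenius_norm (matB r k *m center vw - invmx (matA r 3) *m rotJ)
    = Num.sqrt (4 * (1 - s)).
  rewrite /center eqxx mulmx1 /matB -mulmxBr frobenius_normMl; last first.
    by rewrite invmx_unitary ?trmxC_unitary matA_unitary.
  rewrite -(sqr_frobenius_matA_rotJ k sqr_r_le1).
  by rewrite sqrtr_sqr ger0_norm ?frobenius_norm_ge0.
have dist3 := dist 3%N; rewrite matB3 mul1mx in dist3.
have centerE v : v != vw -> center v = invmx (matA r 3) *m rotJ.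
  by rewrite /center => /negPf ->.
rewrite (frustration_constant (centerE vx isT) (centerE vy isT) (centerE vz isT)).
set a := Num.sqrt _; transitivity (a + a + a); last by ring.
by congr (_ + _ + _); [exact: dist|exact: dist|exact: dist3].
Qed.

(** Since [r ^ 2 = (1 - s) * (1 + s)], the difference of the squares is
    [12 * (1 - s) * (2 * s - 1)]. *)
Lemma center_lt_tree : 0 < r -> r <= 85 / 100 ->
  3 * Num.sqrt (4 * (1 - s)) < 2 * Num.sqrt (6 * r ^+ 2).
Proof.
move=> r_gt0 r_le.
have s_ge0 : 0 <= s := sqrtr_ge0 _.
have s2 : s ^+ 2 = 1 - r ^+ 2 by rewrite sqr_sqrtr // subr_ge0 sqr_r_le1.
have s_lt1 : s < 1.
  by rewrite -(@expr_lt1 _ 2) // s2 gtrBl exprn_gt0.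
have s_gt : 1 / 2 < s.
  rewrite -(ltr_pXn2r (isT : (0 < 2)%N)) ?nnegrE // s2; nra.
rewrite -(ltr_pXn2r (isT : (0 < 2)%N)) ?nnegrE ?mulr_ge0 ?sqrtr_ge0 //.
rewrite !exprMn !sqr_sqrtr ?mulr_ge0 ?sqr_ge0 ?subr_ge0 ?(ltW s_lt1) //.
move: s2 s_lt1 s_gt {s_ge0}; move: (s) => q q2 q_lt1 q_gt.
have -> : r ^+ 2 = (1 - q) * (1 + q).
  by transitivity (1 - q ^+ 2); [rewrite q2|]; ring.
rewrite -subr_gt0.
have -> : 2 ^+ 2 * (6 * ((1 - q) * (1 + q))) - 3 ^+ 2 * (4 * (1 - q))
    = 12 * ((1 - q) * (2 * q - 1)) by ring.
by rewrite !mulr_gt0 // ?subr_gt0 // mulrC -ltr_pdivrMr.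
Qed.

End Values.

Unset Implicit Arguments.

Theorem propositionB1 (R : realType) (r : R)
    (r_gt0 : 0 < r) (r_le : r <= 85%:R / 100%:R)
    (tauT : {set {set 'I_4}} -> 'I_4 -> 'M[R[i]%C]_2)
    (tauTP : forall T, spanning_tree edges T ->
       constant_on T (sigma r) (tauT T)) :
  exists iota treemin : R,
    [/\ is_min [set frustration edges (sigma r) tau
               | tau in [set tau | unitary_valued tau]] iota,
        is_min [set frustration edges (sigma r) (tauT T)
               | T in [set T | spanning_tree edges T]] treemin
      & iota < treemin].
Proof.
have r_ge0 := ltW r_gt0.
have r_le1 : r <= 1 by lra.
have [tau utau tau_min] := frustration_min_attained edges (sigma r).
have star_tree : `[< spanning_tree edges star >].
  by apply/asboolP; exact: star_spanning_tree.
pose F T := frustration edges (sigma r) (tauT T).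
have [T /asboolP Ttree T_min] :=
  arg_minP (P := fun T => `[< spanning_tree edges T >]) F star_tree.
exists (frustration edges (sigma r) tau), (F T); split.
- by split; [exists tau|move=> _ [tau' utau' <-]; exact: tau_min].
- split; first by exists T.
  by move=> _ [T' T'tree <-]; apply: T_min; apply/asboolP.
- apply: le_lt_trans (tau_min _ (center_unitary r_ge0 r_le1)) _.
  rewrite frustration_center //.
  apply: lt_le_trans (center_lt_tree r_ge0 r_le1 r_gt0 r_le) _.
  exact: spanning_tree_frustration Ttree (tauTP _ Ttree).
Qed.
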